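(* Let $\Gamma = (\mathcal{V}, \mathcal{E})$ be a non-empty connected undirected graph (loops and multiple edges allowed), and let $\mathcal{G}(\Gamma) = \big(\Gamma,\ G_{v}\ (v \in \mathcal{V}),\ H_{e},\ \varphi_{\pm e}\ (e \in \mathcal{E})\big)$ be a graph of groups over $\Gamma$, with edge subgroups $H_{+e} = H_e\varphi_{+e}$ and $H_{-e} = H_e\varphi_{-e}$. Suppose that $\mathcal{C}$ is a root class of groups and all vertex groups $G_{v}$ ($v \in \mathcal{V}$) are residually $\mathcal{C}$-groups. If there exists a homomorphism $\sigma$ of the fundamental group $\pi_{1}(\mathcal{G}(\Gamma))$ onto a group from $\mathcal{C}$ acting injectively on all edge subgroups $H_{\varepsilon e}$ ($e \in \mathcal{E}$, $\varepsilon = \pm 1$), then $\pi_{1}(\mathcal{G}(\Gamma))$ is residually a $\mathcal{C}$-group.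
   Context: Classes of groups are understood to be closed under isomorphism. A class of groups $\mathcal{C}$ is a root class if it contains non-trivial groups and is closed under taking subgroups, extensions, and Cartesian (unrestricted) products of the form $\prod_{y \in Y} X_{y}$, where $X, Y \in \mathcal{C}$ and $X_{y}$ is an isomorphic copy of $X$ for each $y \in Y$. A $\mathcal{C}$-group is a group belonging to $\mathcal{C}$. A group $X$ is residually a $\mathcal{C}$-group if for each $x \in X \setminus \{1\}$ there exists a homomorphism $\sigma$ of $X$ onto a group from $\mathcal{C}$ such that $x\sigma \ne 1$. Maps of groups are written on the right. A (directed) graph of groups $\mathcal{G}(\Gamma)$ over $\Gamma$ assigns to each vertex $v \in \mathcal{V}$ a group $G_v$, and to each edge $e \in \mathcal{E}$ a direction (i.e. a labelling of its ends as $e(1)$ and $e(-1)$), a group $H_e$, and injective homomorphisms $\varphi_{+e}\colon H_e \to G_{e(1)}$, $\varphi_{-e}\colon H_e \to G_{e(-1)}$. The groups $G_v$ are the vertex groups; the subgroups $H_{+e} = H_e\varphi_{+e} \leqslant G_{e(1)}$ and $H_{-e} = H_e\varphi_{-e} \leqslant G_{e(-1)}$ are the edge subgroups; $H_{\varepsilon e}$ for $\varepsilon = \pm 1$ means $H_{+e}$ or $H_{-e}$. For a maximal tree $\mathcal{T} = (\mathcal{V}, \mathcal{E}_{\mathcal{T}})$ in $\Gamma$, the fundamental group $\pi_1(\mathcal{G}(\Gamma)) = \pi_1(\mathcal{G}(\Gamma), \mathcal{T})$ is the group generated by the generators of the groups $G_v$ ($v \in \mathcal{V}$) and symbols $t_e$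 ($e \in \mathcal{E} \setminus \mathcal{E}_{\mathcal{T}}$), with defining relations: the relations of the $G_v$; $h\varphi_{+e} = h\varphi_{-e}$ ($e \in \mathcal{E}_{\mathcal{T}}$, $h \in H_e$); and $t_e^{-1}(h\varphi_{+e})t_e = h\varphi_{-e}$ ($e \in \mathcal{E} \setminus \mathcal{E}_{\mathcal{T}}$, $h \in H_e$). Up to isomorphism it does not depend on $\mathcal{T}$, and the vertex groups $G_v$ embed naturally in it and are regarded as its subgroups. *)

(* Defs.v *)
From HB Require Import structures.
From mathcomp Require Import all_boot.
From mathcomp Require Import boolp classical_sets.

Set Implicit Arguments.
Unset Strict Implicit.
Unset Printing Implicit Defensive.

Local Open Scope group_scope.
Local Open Scope quotient_scope.

(* Groups are the possibly infinite groups [groupType], homomorphisms are      *)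
(* [{multiplicative X -> Y}].                                                  *)

Definition surjective (X Y : Type) (f : X -> Y) : Prop :=
  forall y, exists x, f x = y.

Definition isomorphic (X Y : groupType) : Prop :=
  exists f : {multiplicative X -> Y}, bijective f.

Section CartesianProduct.
Variables (Y : Type) (X : Y -> groupType).

Definition cprod : Type := forall y, X y.

HB.instance Definition _ := gen_eqMixin cprod.
HB.instance Definition _ := gen_choiceMixin cprod.

Implicit Types f g h : cprod.

Definition cprod_one : cprod := fun=> 1.
Definition cprod_inv f : cprod := fun y => (f y)^-1.
Definition cprod_mul f g : cprod := fun y => f y * g y.

Fact cprod_mulA : associative cprod_mul.
Proof. by move=> f g h; apply: functional_extensionality_dep => y; exact: mulgA. Qed.
Fact cprod_mul1 : left_id cprod_one cprod_mul.
Proof. by move=> f; apply: functional_extensionality_dep => y; exact: mul1g. Qed.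
Fact cprod_1mul : right_id cprod_one cprod_mul.
Proof. by move=> f; apply: functional_extensionality_dep => y; exact: mulg1. Qed.
Fact cprod_mulV : left_inverse cprod_one cprod_inv cprod_mul.
Proof. by move=> f; apply: functional_extensionality_dep => y; exact: mulVg. Qed.
Fact cprod_Vmul : right_inverse cprod_one cprod_inv cprod_mul.
Proof. by move=> f; apply: functional_extensionality_dep => y; exact: mulgV. Qed.

HB.instance Definition _ := isGroup.Build cprod
  cprod_mulA cprod_mul1 cprod_1mul cprod_mulV cprod_Vmul.

End CartesianProduct.

(* As [C] is closed under isomorphism, closure under subgroups is stated for   *)
(* groups embedding into a [C]-group, and closure under extensions for exact   *)
(* sequences 1 -> N -> X -> Q -> 1.                                            *)
Record root_class (C : groupType -> Prop) : Prop := RootClass {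
  root_iso : forall X Y : groupType, isomorphic X Y -> C X -> C Y;
  root_nontrivial : exists X : groupType, C X /\ exists x : X, x <> 1;
  root_subgroup : forall (X Y : groupType) (i : {multiplicative Y -> X}),
    injective i -> C X -> C Y;
  root_extension : forall (N X Q : groupType)
      (i : {multiplicative N -> X}) (p : {multiplicative X -> Q}),
    injective i -> surjective p ->
    (forall x, p x = 1 <-> exists n, i n = x) ->
    C N -> C Q -> C X;
  root_product : forall (X Y : groupType) (X_ : Y -> groupType),
    (forall y, isomorphic X (X_ y)) -> C X -> C Y -> C (cprod X_)
}.

Definition residually (C : groupType -> Prop) (X : groupType) : Prop :=
  forall x : X, x <> 1 ->
  exists (Q : groupType) (s : {multiplicative X -> Q}),
    [/\ C Q, surjective s & s x <> 1].

(* The group with generators [A] and defining relations [u = v], for [R u v]:  *)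
(* [(a, true)] is the letter a and [(a, false)] the letter a^-1.               *)
Section Presentation.
Variable A : Type.

Definition word : Type := seq (A * bool).

HB.instance Definition _ := gen_eqMixin word.
HB.instance Definition _ := gen_choiceMixin word.

Variable R : word -> word -> Prop.

Inductive pres_eq : word -> word -> Prop :=
| PresRefl u : pres_eq u u
| PresSym u v : pres_eq u v -> pres_eq v u
| PresTrans u v w : pres_eq u v -> pres_eq v w -> pres_eq u w
| PresCat u u' v v' : pres_eq u u' -> pres_eq v v' ->
    pres_eq (u ++ v) (u' ++ v')
| PresCancel a b : pres_eq [:: (a, b); (a, ~~ b)] [::]
| PresRel u v : R u v -> pres_eq u v.

Definition pres_eqb (u v : word) : bool := `[< pres_eq u v >].

Fact pres_eqb_refl : reflexive pres_eqb.
Proof. by move=> u; apply/asboolP; exact: PresRefl. Qed.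
Fact pres_eqb_sym : symmetric pres_eqb.
Proof. by move=> u v; apply/asboolP/asboolP; exact: PresSym. Qed.
Fact pres_eqb_trans : transitive pres_eqb.
Proof. by move=> v u w /asboolP uv /asboolP vw; apply/asboolP; exact: PresTrans vw. Qed.

Canonical pres_equiv := EquivRel pres_eqb pres_eqb_refl pres_eqb_sym pres_eqb_trans.

Definition presented : Type := {eq_quot pres_equiv}.

HB.instance Definition _ := Choice.on presented.

Definition pres_class (u : word) : presented := \pi_({eq_quot pres_equiv}) u.
Definition pres_repr (x : presented) : word := repr (x : {eq_quot pres_equiv}).

Fact pres_reprK x : pres_class (pres_repr x) = x.
Proof. exact: reprK. Qed.

Lemma pres_classP u v : pres_class u = pres_class v <-> pres_eq u v.
Proof.
split=> [/eqquotP/asboolP //|uv].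
by apply/eqquotP/asboolP.
Qed.

Definition word_inv (u : word) : word := rev [seq (l.1, ~~ l.2) | l <- u].

Lemma pres_eq_Vcat u : pres_eq (word_inv u ++ u) [::].
Proof.
elim: u => [|[a b] u IHu]; first exact: PresRefl.
rewrite /word_inv /= rev_cons -cats1 -catA /=.
apply: PresTrans IHu; apply: PresCat; first exact: PresRefl.
rewrite -[X in pres_eq _ X]cat0s -[_ :: _]/([:: (a, ~~ b); (a, b)] ++ u).
apply: PresCat; last exact: PresRefl.
by have := PresCancel a (~~ b); rewrite negbK.
Qed.

Lemma word_invK : involutive word_inv.
Proof.
move=> u; rewrite /word_inv map_rev revK -map_comp -[RHS]map_id.
by apply: eq_map => -[a b] /=; rewrite negbK.
Qed.

Lemma pres_eq_catV u : pres_eq (u ++ word_inv u) [::].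
Proof. by have := pres_eq_Vcat (word_inv u); rewrite word_invK. Qed.

Definition pres_one : presented := pres_class [::].
Definition pres_inv (x : presented) : presented :=
  pres_class (word_inv (pres_repr x)).
Definition pres_mul (x y : presented) : presented :=
  pres_class (pres_repr x ++ pres_repr y).

Lemma pres_eq_repr u : pres_eq (pres_repr (pres_class u)) u.
Proof. by apply/pres_classP; rewrite pres_reprK. Qed.

Lemma pres_mulE u v : pres_mul (pres_class u) (pres_class v) = pres_class (u ++ v).
Proof. by apply/pres_classP; apply: PresCat; exact: pres_eq_repr. Qed.

Fact pres_mulA : associative pres_mul.
Proof.
move=> x y z; rewrite -[x]pres_reprK -[y]pres_reprK -[z]pres_reprK.
by rewrite !pres_mulE catA.
Qed.
Fact pres_mul1 : left_id pres_one pres_mul.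
Proof. by move=> x; rewrite -[x]pres_reprK pres_mulE. Qed.
Fact pres_1mul : right_id pres_one pres_mul.
Proof. by move=> x; rewrite -[x]pres_reprK pres_mulE cats0. Qed.
Fact pres_mulV : left_inverse pres_one pres_inv pres_mul.
Proof.
move=> x; rewrite -[x in pres_mul _ x]pres_reprK pres_mulE.
by apply/pres_classP; exact: pres_eq_Vcat.
Qed.
Fact pres_Vmul : right_inverse pres_one pres_inv pres_mul.
Proof.
move=> x; rewrite -[x in pres_mul x _]pres_reprK pres_mulE.
by apply/pres_classP; exact: pres_eq_catV.
Qed.

HB.instance Definition _ := isGroup.Build presented
  pres_mulA pres_mul1 pres_1mul pres_mulV pres_Vmul.

End Presentation.

(* [edge_end e true] is e(1) and [edge_end e false] is e(-1). The labelling is *)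
(* only a direction: walks traverse edges both ways, so that connectedness and *)
(* trees are those of the underlying undirected graph.                         *)
Record multigraph := Multigraph {
  vertex : choiceType;
  edge : choiceType;
  edge_end : edge -> bool -> vertex
}.

Section Trees.
Variable Gamma : multigraph.
Implicit Types (S : set (edge Gamma)) (u v : vertex Gamma).

(* The step [(e, b)] traverses e from [edge_end e b] to its other end.         *)
Fixpoint walk S u (p : seq (edge Gamma * bool)) v : Prop :=
  if p is (e, b) :: p' then
    [/\ S e, edge_end e b = u & walk S (edge_end e (~~ b)) p' v]
  else u = v.

Definition connected S : Prop := forall u v, exists p, walk S u p v.

Definition acyclic S : Prop :=
  forall v p, walk S v p v -> uniq [seq s.1 | s <- p] -> p = [::].

(* [S] is the edge set of a tree (V, S) containing all vertices; such a tree   *)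
(* is automatically maximal, and in a connected graph every maximal tree is of *)
(* this form.                                                                  *)
Definition maximal_tree S : Prop := connected S /\ acyclic S.

End Trees.

Record graph_of_groups (Gamma : multigraph) := GraphOfGroups {
  vgroup : vertex Gamma -> groupType;
  egroup : edge Gamma -> groupType;
  emap : forall (e : edge Gamma) (b : bool),
    {multiplicative egroup e -> vgroup (edge_end e b)};
  emap_inj : forall e b, injective (emap e b)
}.

Section FundamentalGroup.
Variables (Gamma : multigraph) (G : graph_of_groups Gamma).
Variable T : set (edge Gamma).

Definition edge_subgroup (e : edge Gamma) (b : bool) :
    set (vgroup G (edge_end e b)) :=
  range (emap G e b).

Inductive pi1_gen : Type :=
| VGen (v : vertex Gamma) of vgroup G v
| TGen (e : edge Gamma) of ~ T e.

Inductive pi1_rel : word pi1_gen -> word pi1_gen -> Prop :=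
| VertexRel v (g h : vgroup G v) :
    pi1_rel [:: (VGen g, true); (VGen h, true)] [:: (VGen (g * h), true)]
| TreeRel e (h : egroup G e) : T e ->
    pi1_rel [:: (VGen (emap G e true h), true)]
            [:: (VGen (emap G e false h), true)]
| StableRel e (nTe : ~ T e) (h : egroup G e) :
    pi1_rel [:: (TGen nTe, false); (VGen (emap G e true h), true);
                (TGen nTe, true)]
            [:: (VGen (emap G e false h), true)].

Definition pi1 : groupType := presented pi1_rel.

Definition vertex_incl (v : vertex Gamma) (g : vgroup G v) : pi1 :=
  pres_class pi1_rel [:: (VGen g, true)].

Fact vertex_incl_mul v : {morph @vertex_incl v : g h / g * h}.
Proof.
move=> g h; rewrite /vertex_incl [RHS]pres_mulE; apply/pres_classP.
by apply: PresSym; apply: PresRel; exact: VertexRel.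
Qed.

HB.instance Definition _ v :=
  isMultiplicative.Build (vgroup G v) pi1 (@vertex_incl v) (@vertex_incl_mul v).

End FundamentalGroup.

Arguments edge_subgroup {Gamma} G e b.
Arguments pi1 {Gamma} G T.
Arguments vertex_incl {Gamma} G T v g.

(* Main.v *)
From HB Require Import structures.
Require Import Defs.
From mathcomp Require Import all_boot.
From mathcomp Require Import boolp classical_sets.

(** Let the sigma of the hypothesis have kernel N.  Since N meets the edge
subgroups trivially, it acts on the Bass-Serre tree with trivial edge
stabilisers, so it is a free product of a free group and of subgroups of
conjugates of the vertex groups.  The proof runs the separation argument that
this structure suggests, but inside explicit wreath products, so that neither
the tree nor the free product has to be built.

A representation of the graph of groups consists of homomorphisms of all
vertex groups into one group K and of one element of K for each edge,
compatible with the edge maps.  Transport along a spanning tree turns it into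
a homomorphism of the fundamental group ([pi1_hom]), and turns an element of
the fundamental group into a closed route, a word of vertex group elements and
edge crossings, with the same value in every representation ([word_route]).
For x <> 1 the task is to find a representation in a C-group where the route
of x has a value <> 1; the route may be taken of minimal length.

The starting point is sigma, and the only tool is [wreath_lift].  Let a
representation in K be injective on the edge groups.  Then each H_e acts
freely on K by right translations, so any two homomorphisms of H_e to B become
conjugate in the wreath product of B by K when they are placed above H_e -> K.
Therefore arbitrary homomorphisms rho_v from the vertex groups to B lift, as
constant functions, to a representation in the wreath product, which again
belongs to C when B and K do.  Moreover the element of each edge e may carry
an arbitrary function K -> B that is constant on the cosets of H_e.

The choice of the rho_v makes a given g <> 1 of a vertex group nontrivial
([dense_vertex]), and then keeps a g outside H_e away from the image of H_e
([dense_edge_subgroup]).  The choice of the coset functions unfolds loops.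
The cosets in K of the images of the vertex and edge groups are the vertices
and edges of a graph, a quotient of the Bass-Serre tree, where routes lift to
paths.  When shorter loops have already been opened, the lift of a closed
irreducible route crosses its first edge only once ([first_edge_simple]); a
coset function supported on that edge then opens the route too
([first_edge_lift], [dense_off_vertex]).  All these choices refine the given
representation and are stable under further refinement, so that finitely many
of them can be made one after the other ([dense_forall]). *)

Set Implicit Arguments.
Unset Strict Implicit.
Unset Printing Implicit Defensive.

Local Open Scope group_scope.

(** * Homomorphisms, images and presentations *)

Section GroupHom.
Variables (X Y : groupType) (f : {multiplicative X -> Y}).

Lemma hom1 : f 1 = 1.
Proof. by apply: (mulgI (f 1)); rewrite -gmulfM !mulg1. Qed.

Lemma homV x : f x^-1 = (f x)^-1.
Proof. by apply: (mulgI (f x)); rewrite -gmulfM !mulgV hom1. Qed.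

End GroupHom.

Section Image.
Variables (X Y : groupType) (f : {multiplicative X -> Y}).

Definition in_image : {pred Y} := fun y => `[< exists x, f x = y >].

Fact in_image_closed : group_closed in_image.
Proof.
split; first by apply/asboolP; exists 1; rewrite hom1.
move=> _ _ /asboolP[x <-] /asboolP[y <-].
by apply/asboolP; exists (x / y); rewrite gmulfM homV.
Qed.

Definition image_group : Type := {y : Y | in_image y}.

HB.instance Definition _ := SubType.on image_group.
HB.instance Definition _ := Choice.on image_group.
HB.instance Definition _ :=
  SubChoice_isSubGroup.Build Y in_image image_group in_image_closed.

Fact to_image_subproof x : in_image (f x).
Proof. by apply/asboolP; exists x. Qed.

Definition to_image (x : X) : image_group := Sub (f x) (to_image_subproof x).

Fact to_image_mul : {morph to_image : x y / x * y}.
Proof. by move=> x y; apply: val_inj; rewrite /= gmulfM. Qed.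

HB.instance Definition _ := isMultiplicative.Build X image_group to_image to_image_mul.

Lemma to_image_surjective : surjective to_image.
Proof.
move=> [y Yy]; case/asboolP: (Yy) => x fx.
by exists x; apply: val_inj.
Qed.

End Image.

Section PresentationHom.
Variables (A : Type) (K : groupType) (f : A -> K).

Fixpoint word_eval (u : word A) : K :=
  if u is (a, b) :: u' then (if b then f a else (f a)^-1) * word_eval u' else 1.

Lemma word_eval_cat u v : word_eval (u ++ v) = word_eval u * word_eval v.
Proof. by elim: u => [|[a b] u IH] /=; rewrite ?mul1g // IH mulgA. Qed.

Lemma word_eval_inv u : word_eval (word_inv u) = (word_eval u)^-1.
Proof.
elim: u => [|[a b] u IH] /=; first by rewrite invg1.
rewrite /word_inv /= rev_cons -cats1 word_eval_cat -/(word_inv u) IH /= mulg1.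
by rewrite invgM; case: b; rewrite ?invgK.
Qed.

Lemma presented_hom (R : word A -> word A -> Prop) :
  (forall u v, R u v -> word_eval u = word_eval v) ->
  exists s : {multiplicative presented R -> K},
    forall u, s (pres_class R u) = word_eval u.
Proof.
move=> Rf; have eqf u v : pres_eq R u v -> word_eval u = word_eval v.
  elim=> {u v}// [u v w _ -> _ -> //|u u' v v' _ uu' _ vv'|a b].
    by rewrite !word_eval_cat uu' vv'.
  by case: b; rewrite /= mulg1 ?mulgV ?mulVg.
pose s x := word_eval (pres_repr (R := R) x).
have sE u : s (pres_class R u) = word_eval u by apply: eqf; exact: pres_eq_repr.
have sM : {morph s : x y / x * y}.
  by move=> x y; rewrite sE word_eval_cat.
by exists (HB.pack_for {multiplicative presented R -> K} s
  (isMultiplicative.Build _ _ s sM)).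
Qed.

End PresentationHom.

Lemma eq_word_eval (A : Type) (K : groupType) (f g : A -> K) :
  f =1 g -> word_eval f =1 word_eval g.
Proof. by move=> fg; elim=> [|[a b] u /= ->] //; rewrite fg. Qed.

Lemma word_eval_class (A : Type) (R : word A -> word A -> Prop) (u : word A) :
  word_eval (fun a => pres_class R [:: (a, true)] : presented R) u = pres_class R u.
Proof.
elim: u => [|[a b] u /= ->] //.
rewrite (_ : (if b then _ else _) = pres_class R [:: (a, b)]).
  by rewrite [LHS]pres_mulE.
case: b => //; apply: mulg1_eq; rewrite [LHS]pres_mulE.
by apply/pres_classP; exact: PresCancel.
Qed.

(** * Wreath products *)

Section Wreath.
Variables B K : groupType.

(** The permutational form of the unrestricted wreath product: [K] acts on
functions by right translation of the argument. *)
Record wreath := Wreath { fibre : K -> B; top : K }.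

HB.instance Definition _ := gen_eqMixin wreath.
HB.instance Definition _ := gen_choiceMixin wreath.

Implicit Types x y z : wreath.

Lemma wreath_eq x y : (forall k, fibre x k = fibre y k) -> top x = top y -> x = y.
Proof. by case: x y => [f k] [g l] /= /funext-> ->. Qed.

Definition wreath_one := Wreath (fun=> 1) 1.
Definition wreath_inv x := Wreath (fun k => (fibre x (k / top x))^-1) (top x)^-1.
Definition wreath_mul x y :=
  Wreath (fun k => fibre x k * fibre y (k * top x)) (top x * top y).

Fact wreath_mulA : associative wreath_mul.
Proof. by move=> x y z; apply: wreath_eq => [k|] /=; rewrite !mulgA. Qed.
Fact wreath_mul1 : left_id wreath_one wreath_mul.
Proof. by move=> x; apply: wreath_eq => [k|] /=; rewrite ?mulg1 mul1g. Qed.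
Fact wreath_1mul : right_id wreath_one wreath_mul.
Proof. by move=> x; apply: wreath_eq => [k|] /=; rewrite mulg1. Qed.
Fact wreath_mulV : left_inverse wreath_one wreath_inv wreath_mul.
Proof. by move=> x; apply: wreath_eq => [k|] /=; rewrite mulVg. Qed.
Fact wreath_Vmul : right_inverse wreath_one wreath_inv wreath_mul.
Proof. by move=> x; apply: wreath_eq => [k|] /=; rewrite ?mulgK mulgV. Qed.

HB.instance Definition _ := isGroup.Build wreath
  wreath_mulA wreath_mul1 wreath_1mul wreath_mulV wreath_Vmul.

Fact top_mul : {morph top : x y / x * y}. Proof. by []. Qed.
HB.instance Definition _ := isMultiplicative.Build wreath K top top_mul.

Definition wreath_base (f : cprod (fun _ : K => B)) : wreath := Wreath f 1.

Fact wreath_base_mul : {morph wreath_base : f g / f * g}.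
Proof. by move=> f g; apply: wreath_eq => [k|] /=; rewrite mulg1. Qed.
HB.instance Definition _ := isMultiplicative.Build _ wreath wreath_base wreath_base_mul.

(** The base group is a Cartesian power of [B] indexed by the group [K], and the
quotient by it is [K]. *)
Lemma wreath_root_class (C : groupType -> Prop) :
  root_class C -> C B -> C K -> C wreath.
Proof.
move=> rC CB CK.
apply: (@root_extension C rC (cprod (fun _ : K => B)) wreath K wreath_base top) => //.
- by move=> f g [].
- by move=> k; exists (Wreath (fun=> 1) k).
- move=> x; split=> [x1|[f <-] //].
  by exists (fibre x); apply: wreath_eq.
- apply: (root_product rC _ CB CK) => _.
  by exists idfun; exists idfun.
Qed.

End Wreath.

(** * Representations of a graph of groups *)

Section Representations.
Variables (Gamma : multigraph) (G : graph_of_groups Gamma).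

(** Here every edge has an element, also the edges of a spanning tree, so that no
tree has to be respected when a representation is modified.  They
correspond to the homomorphisms from the group generated by the vertex groups and a stable letter
for each edge. *)
Record representation := Representation {
  target : groupType;
  vrep : forall v : vertex Gamma, {multiplicative vgroup G v -> target};
  erep : edge Gamma -> target;
  erep_rel : forall e h,
    vrep _ (emap G e true h) * erep e = erep e * vrep _ (emap G e false h)
}.

Implicit Types K : representation.

Arguments vrep r {v}.

Definition step K (e : edge Gamma) (b : bool) : target K :=
  if b then erep K e else (erep K e)^-1.

Lemma step_rel K e b h :
  vrep K (emap G e b h) * step K e b = step K e b * vrep K (emap G e (~~ b) h).
Proof.
case: b => /=; first exact: erep_rel.
by apply: (mulgI (erep K e)); rewrite mulVKg mulgA -erep_rel mulgK.
Qed.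

Lemma stepN K e b : step K e (~~ b) = (step K e b)^-1.
Proof. by case: b => /=; rewrite ?invgK. Qed.

(** Whatever [K] separates is separated by [K'] as well. *)
Definition refines K' K : Prop :=
  exists p : {multiplicative target K' -> target K},
    (forall v (g : vgroup G v), p (vrep K' g) = vrep K g) /\
    (forall e, p (erep K' e) = erep K e).

Lemma refines_refl K : refines K K.
Proof. by exists idfun. Qed.

Lemma refines_trans K2 K1 K3 : refines K1 K2 -> refines K2 K3 -> refines K1 K3.
Proof.
move=> [p [pv pe]] [q [qv qe]]; exists (q \o p).
by split=> [v g|e] /=; rewrite ?pv ?pe ?qv ?qe.
Qed.

(** ** Routes *)

Inductive letter : Type :=
| Vert (v : vertex Gamma) of vgroup G v
| Edge (e : edge Gamma) (b : bool).

Definition is_edge (l : letter) : bool := if l is Edge _ _ then true else false.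

Implicit Types s : seq letter.

Fixpoint route (u : vertex Gamma) s (v : vertex Gamma) : Prop :=
  match s with
  | [::] => u = v
  | Vert u' _ :: s' => u' = u /\ route u s' v
  | Edge e b :: s' => edge_end e b = u /\ route (edge_end e (~~ b)) s' v
  end.

Fixpoint eval K s : target K :=
  match s with
  | [::] => 1
  | Vert _ g :: s' => vrep K g * eval K s'
  | Edge e b :: s' => step K e b * eval K s'
  end.

Lemma route_cat u s t v : route u (s ++ t) v <-> exists2 w, route u s w & route w t v.
Proof.
elim: s u => [|[u' g|e b] s IH] u /=.
- by split=> [r|[w -> //]]; exists u.
- split=> [[-> /IH[w r1 r2]]|[w [-> r1] r2]]; first by exists w.
  by split=> //; apply/IH; exists w.
- split=> [[-> /IH[w r1 r2]]|[w [-> r1] r2]]; first by exists w.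
  by split=> //; apply/IH; exists w.
Qed.

Lemma eval_cat K s t : eval K (s ++ t) = eval K s * eval K t.
Proof. by elim: s => [|[u g|e b] s IH] /=; rewrite ?mul1g // IH mulgA. Qed.

Lemma eval_refines K' K (p : {multiplicative target K' -> target K}) s :
  (forall v (g : vgroup G v), p (vrep K' g) = vrep K g) ->
  (forall e, p (erep K' e) = erep K e) ->
  p (eval K' s) = eval K s.
Proof.
move=> pv pe; elim: s => [|[u g|e b] s IH] /=; first exact: hom1.
  by rewrite gmulfM pv IH.
by rewrite gmulfM IH /step; case: b; rewrite ?homV pe.
Qed.

(** Minimality among the routes with the same ends and the same values.  It
yields what a reduced word must satisfy ([edge_free_irreducible],
[no_backtrack], [no_pinch]) and passes to factors ([irreducible_cat]). *)
Definition irreducible u s v : Prop :=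
  route u s v /\
  forall s', route u s' v -> (forall K, eval K s' = eval K s) -> size s <= size s'.

Lemma irreducible_cat u s t v : irreducible u (s ++ t) v ->
  exists2 w, irreducible u s w & irreducible w t v.
Proof.
move=> [/route_cat[w rs rt] min]; exists w; split=> // s' rs' es'.
  have := min (s' ++ t); rewrite !size_cat leq_add2r; apply.
    by apply/route_cat; exists w.
  by move=> K; rewrite !eval_cat es'.
have := min (s ++ s'); rewrite !size_cat leq_add2l; apply.
  by apply/route_cat; exists w.
by move=> K; rewrite !eval_cat es'.
Qed.

Lemma irreducible_Edge u e b s v : irreducible u (Edge e b :: s) v ->
  u = edge_end e b /\ irreducible (edge_end e (~~ b)) s v.
Proof. by rewrite -cat1s => /irreducible_cat[w [[-> <-] _] ?]. Qed.

Lemma exists_irreducible u s v : route u s v ->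
  exists2 s', irreducible u s' v & forall K, eval K s' = eval K s.
Proof.
elim: {s}(size s) {-2}s (leqnn (size s)) => [|n IH] s les rs.
  exists s => //; split=> // s' _ _; exact: leq_trans les _.
case: (pselect (irreducible u s v)) => [irr|nirr]; first by exists s.
have [s' [rs' es' lts']] : exists s',
    [/\ route u s' v, forall K, eval K s' = eval K s & size s' < size s].
  apply: contrapT => no; apply: nirr; split=> // s' rs' es'.
  by rewrite leqNgt; apply/negP => lts'; apply: no; exists s'.
have [|t irt et] := IH s' _ rs'; first by rewrite -ltnS (leq_trans lts').
by exists t => // K; rewrite et.
Qed.

Lemma edge_free_irreducible u s v : irreducible u s v -> ~~ has is_edge s ->
  s = [::] \/ exists g : vgroup G u, s = [:: Vert g].
Proof.
case: s => [|[u1 g|e b] [|[u2 h|e' b'] s]] //; try by left.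
  by move=> [[/= eu _] _] _; right; case: _ / eu; exists g.
move=> [[/= eu [eu2 rs]] min] _.
move: eu2 rs min; case: _ / eu => {u} eu2; case: _ / eu2 g => g rs min.
suff: size (Vert g :: Vert h :: s) <= size (Vert (g * h) :: s) by rewrite /= ltnn.
by apply: min => // K /=; rewrite gmulfM mulgA.
Qed.

Lemma no_backtrack u e b s v : ~ irreducible u (Edge e b :: Edge e (~~ b) :: s) v.
Proof.
move=> [[/= eu [_ rs]] min].
suff: size (Edge e b :: Edge e (~~ b) :: s) <= size s by rewrite /= ltnNge leqnSn.
apply: min => [|K]; first by move: rs; rewrite negbK eu.
by rewrite /= stepN mulVKg.
Qed.

Lemma no_pinch u e b h s v :
  ~ irreducible u [:: Edge e b, Vert (emap G e (~~ b) h), Edge e (~~ b) & s] v.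
Proof.
move=> [[/= eu [_ [_ rs]]] min].
suff: size [:: Edge e b, Vert (emap G e (~~ b) h), Edge e (~~ b) & s]
    <= size (Vert (emap G e b h) :: s) by rewrite /= ltnNge leqnSn.
apply: min => [|K] /=; first by move: rs; rewrite negbK eu.
by rewrite stepN !mulgA -step_rel mulgK.
Qed.

End Representations.

Arguments vrep {Gamma G} r {v}.
Arguments Vert {Gamma G v}.
Arguments Edge {Gamma G}.

(** * Lifting a representation to a wreath product *)

Section WreathLift.
Variables (Gamma : multigraph) (G : graph_of_groups Gamma).
Variables (K : representation G) (B : groupType).
Variable rho : forall v : vertex Gamma, {multiplicative vgroup G v -> B}.
(* A coset representative [r k] of [k] being chosen, [coord e k] is the element
   of the edge group with [k = r k * coord e k]. *)
Variable coord : forall e : edge Gamma, target K -> egroup G e.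
Hypothesis coordM : forall e k h,
  coord e (k * vrep K (emap G e true h)) = coord e k * h.
Variable twist : edge Gamma -> target K -> B.
Hypothesis twist_coset : forall e k h,
  twist e (k * vrep K (emap G e true h)) = twist e k.

Definition lift_vrep v (g : vgroup G v) : wreath B (target K) :=
  Wreath (fun=> rho v g) (vrep K g).

Fact lift_vrep_mul v : {morph @lift_vrep v : g h / g * h}.
Proof. by move=> g h; apply: wreath_eq => [k|]; rewrite /= gmulfM. Qed.

HB.instance Definition _ v :=
  isMultiplicative.Build (vgroup G v) (wreath B (target K))
    (@lift_vrep v) (@lift_vrep_mul v).

(** Apart from [twist], this conjugates the action of the edge group through
[rho] at its positive end, trivialised by [coord], to the one at its negative
end. *)
Definition lift_erep (e : edge Gamma) : wreath B (target K) :=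
  Wreath (fun k => (rho _ (emap G e true (coord e k)))^-1 * twist e k *
                   rho _ (emap G e false (coord e k))) (erep K e).

Fact lift_rel e h :
  lift_vrep (emap G e true h) * lift_erep e = lift_erep e * lift_vrep (emap G e false h).
Proof.
apply: wreath_eq => [k|] /=; last exact: erep_rel.
by rewrite coordM twist_coset !gmulfM invgM !mulgA mulgV mul1g.
Qed.

Definition wreath_lift : representation G :=
  @Representation Gamma G (wreath B (target K))
    (fun v => @lift_vrep v) lift_erep lift_rel.

Lemma wreath_lift_refines : refines wreath_lift K.
Proof. by exists (@top B (target K)). Qed.

Lemma top_eval s : top (eval wreath_lift s) = eval K s.
Proof. exact: (eval_refines (K' := wreath_lift) (p := @top B (target K))). Qed.

(** The fibre coordinate of a product is collected along the path of prefix
values in [K], so for trivial [rho] it is trivial when no crossing on that path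
contributes. *)
Lemma fibre_eval s k :
  (forall v (g : vgroup G v), rho v g = 1) ->
  (forall s1 e b s2, s = s1 ++ Edge e b :: s2 ->
     fibre (step wreath_lift e b) (k * eval K s1) = 1) ->
  fibre (eval wreath_lift s) k = 1.
Proof.
move=> rho1; elim: s k => [|[u g|e b] s IH] k trivial_step //=.
  rewrite rho1 mul1g; apply: IH => s1 e b s2 es.
  by have := trivial_step (Vert g :: s1) e b s2; rewrite es /= mulgA; apply.
rewrite (_ : fibre (step wreath_lift e b) k = 1); last first.
  by have := trivial_step [::] e b s; rewrite /= mulg1; apply.
rewrite mul1g; apply: IH => s1 e' b' s2 es.
have := trivial_step (Edge e b :: s1) e' b' s2; rewrite es /= mulgA.
by case: (b); apply.
Qed.

End WreathLift.

Lemma coset_coordinate (H K : groupType) (j : {multiplicative H -> K}) :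
  injective j -> exists c : K -> H, forall k h, c (k * j h) = c k * h.
Proof.
move=> inj_j; pose coset k : pred K := fun l => `[< exists h, l = k * j h >].
have in_coset k : coset k k by apply/asboolP; exists 1; rewrite hom1 mulg1.
(* [choose] depends on the extent of the coset only, whence [rM] below. *)
pose r k := choose (coset k) k.
have rP k : {h | k = r k * j h}.
  apply: cid; have /asboolP[h rk] := chooseP (in_coset k).
  by exists h^-1; rewrite homV [r k]rk mulgK.
have rM k h : r (k * j h) = r k.
  have e : coset (k * j h) =1 coset k.
    move=> l; apply/asboolP/asboolP => -[h' ->].
      by exists (h * h'); rewrite gmulfM mulgA.
    by exists (h^-1 * h'); rewrite gmulfM homV mulgA mulgK.
  rewrite /r (eq_choose e); apply: choose_id => //.
  by rewrite -e.
exists (fun k => sval (rP k)) => k h; apply/inj_j/(mulgI (r k)).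
rewrite gmulfM mulgA -(svalP (rP k)) -[X in X * _](rM k h).
by rewrite -(svalP (rP _)).
Qed.

(** * Separating elements by representations in the class *)

Section Separation.
Variables (C : groupType -> Prop) (Gamma : multigraph) (G : graph_of_groups Gamma).
Hypothesis rC : root_class C.

Implicit Types K : representation G.

Definition admissible K : Prop :=
  C (target K) /\ forall e b, injective (fun h => vrep K (emap G e b h)).

Lemma admissible_refines K' K :
  C (target K') -> refines K' K -> admissible K -> admissible K'.
Proof.
move=> CK' [p [pv _]] [_ inj]; split=> // e b h h' eh.
by apply: (inj e b); rewrite /= -!pv eh.
Qed.

Lemma admissible_coordinates K : admissible K ->
  exists c : forall e : edge Gamma, target K -> egroup G e,
    forall e k h, c e (k * vrep K (emap G e true h)) = c e k * h.
Proof.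
move=> [_ inj]; suff c e : {c : target K -> egroup G e |
    forall k h, c (k * vrep K (emap G e true h)) = c k * h}.
  by exists (fun e => sval (c e)) => e; exact: (svalP (c e)).
by apply: cid; have := @coset_coordinate _ _ (vrep K \o emap G e true); apply; exact: inj.
Qed.

(** Density in the set of admissible representations ordered by refinement;
persistent properties are its open sets. *)
Definition dense (D : representation G -> Prop) : Prop :=
  forall K, admissible K -> exists K', [/\ admissible K', refines K' K & D K'].

Definition persistent (D : representation G -> Prop) : Prop :=
  forall K' K, refines K' K -> D K -> D K'.

Lemma dense_forall (D : nat -> representation G -> Prop) :
  (forall i, persistent (D i)) -> (forall i, dense (D i)) ->
  forall n, dense (fun K => forall i, i < n -> D i K).
Proof.
move=> perD denD; elim=> [|n IH] K adK.
  by exists K; split=> //; exact: refines_refl.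
have [K1 [ad1 ref1 D1]] := IH K adK.
have [K2 [ad2 ref2 D2]] := denD n K1 ad1.
exists K2; split=> // [|i]; first exact: refines_trans ref1.
rewrite ltnS leq_eqVlt => /predU1P[-> //|lti].
by apply: perD ref2 _; exact: D1.
Qed.

(** A homomorphism of the vertex group at [v] into [B] with [g] outside its
kernel, together with trivial ones at the other vertices, lifts to the wreath
product. *)
Lemma dense_vertex v (g : vgroup G v) :
  residually C (vgroup G v) -> g <> 1 -> dense (fun K => vrep K g <> 1).
Proof.
move=> resC /resC[B [s [CB _ sg]]] K adK.
have /(_ _)/cid-rhoP u : exists r : {multiplicative vgroup G u -> B},
    forall E : v = u, r (eq_rect v (vgroup G) g u E) <> 1.
  case: (pselect (v = u)) => [E|nE]; last by exists (@one_fun _ B).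
  by case: _ / E; exists s => E; rewrite eq_axiomK.
pose rho u := sval (rhoP u).
have [c cM] := admissible_coordinates adK.
have t1 (e : edge Gamma) (k : target K) (h : egroup G e) :
  (fun _ _ => 1 : B) e (k * vrep K (emap G e true h)) = (fun _ _ => 1) e k by [].
pose K' := wreath_lift rho cM t1.
have ref : refines K' K by exact: wreath_lift_refines.
exists K'; split=> //.
  apply: (admissible_refines _ ref adK); apply: wreath_root_class => //.
  by case: (adK).
move=> /(congr1 (fun x : wreath _ _ => fibre x 1)) /=.
exact: (svalP (rhoP v) erefl).
Qed.

(** If [g] and [h] have the same value, it suffices to make [g / h] nontrivial:
by injectivity on the edge group, no other element of it has the value of [g]
in any refinement. *)
Lemma dense_edge_subgroup e b (g : vgroup G (edge_end e b)) :
  residually C (vgroup G (edge_end e b)) -> (forall h, g <> emap G e b h) ->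
  dense (fun K => forall h, vrep K g <> vrep K (emap G e b h)).
Proof.
move=> resC gH K adK.
case: (pselect (exists h, vrep K g = vrep K (emap G e b h))) => [[h gh]|no]; last first.
  exists K; split=> //; first exact: refines_refl.
  by move=> h gh; apply: no; exists h.
have neq1 : g / emap G e b h <> 1 by move=> /divg1_eq; exact: gH.
have [K' [ad' ref sep]] := dense_vertex resC neq1 adK.
exists K'; split=> // h' gh'; apply: sep.
case: ref => p [pv pe]; rewrite gmulfM homV gh'.
suff -> : h' = h by rewrite mulgV.
case: adK => _ inj; apply: (inj e b).
by rewrite -gh -!pv gh'.
Qed.

Definition off_vertex (u : vertex Gamma) s K : Prop :=
  forall g : vgroup G u, eval K s <> vrep K g.

Definition off_edge e b s K : Prop :=
  forall h : egroup G e, eval K s <> vrep K (emap G e b h).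

Lemma off_edge_persistent e b s : persistent (off_edge e b s).
Proof.
move=> K' K [p [pv pe]] off h eh; apply: (off h).
by rewrite -pv -eh (eval_refines _ pv pe).
Qed.

Lemma split_first_edge (s : seq (letter G)) : has (@is_edge _ _) s ->
  exists s1 e b s2, s = s1 ++ Edge e b :: s2 /\ ~~ has (@is_edge _ _) s1.
Proof.
elim: s => [|[u g|e b] s IH] //= es; last by exists [::], e, b, s.
have [s1 [e [b [s2 [-> ns1]]]]] := IH es.
by exists (Vert g :: s1), e, b, s2.
Qed.

(** ** Opening a route at its first edge *)

Section FirstEdge.
Hypothesis resV : forall v : vertex Gamma, residually C (vgroup G v).
Variables (s1 s2 : seq (letter G)) (e : edge Gamma) (b : bool).

(** A later crossing of [e], in the direction [b'] after [m], lifts to the same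
coset of the edge group as the first crossing exactly when this route, closed
at [edge_end e b], takes its value in the edge subgroup: crossing backwards,
one returns to the end from which the coset was first entered. *)
Definition recrossing b' m : seq (letter G) :=
  Edge e b :: m ++ (if b' == b then [::] else [:: Edge e b']).

Definition first_edge_simple K : Prop :=
  forall m b' r, s2 = m ++ Edge e b' :: r -> off_edge e b (recrossing b' m) K.

(** In the direction [b], the recrossing is a shorter closed route.  In the
opposite direction it is conjugate by the crossing of [e] to [m], which is
either a shorter closed route with an edge, or a single vertex group element
outside the edge subgroup by irreducibility. *)
Lemma recrossing_dense u v m b' r :
  (forall w t, size t <= size m + 1 -> irreducible w t w -> has (@is_edge _ _) t ->
     dense (off_vertex w t)) ->
  irreducible u (s1 ++ Edge e b :: m ++ Edge e b' :: r) v ->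
  dense (off_edge e b (recrossing b' m)).
Proof.
move=> IH /irreducible_cat[u1 _ irr].
have [u1E _] := irreducible_Edge irr; subst u1.
rewrite /recrossing; case: eqP irr => [->|nb'] irr K adK.
  rewrite -cat_cons in irr; have [w irr1] := irreducible_cat irr.
  move=> /irreducible_Edge[wE _]; subst w.
  have les : size (Edge e b :: m) <= size m + 1 by rewrite addn1.
  have [K' [ad' ref off]] := IH _ _ les irr1 isT K adK.
  by exists K'; split=> // h; rewrite cats0; exact: off.
have {nb'}b'E : b' = ~~ b by move: nb'; case: (b); case: (b').
subst b'; have [K' [ad' ref off]] : exists K',
    [/\ admissible K', refines K' K & off_edge e (~~ b) m K'].
  have [_ irr1] := irreducible_Edge irr.
  have [w irrm /irreducible_Edge[wE _]] := irreducible_cat irr1; subst w.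
  case: (boolP (has (@is_edge _ _) m)) => [em|nem].
    have [K' [ad' ref off]] := IH _ _ (leq_addr _ _) irrm em K adK.
    by exists K'; split=> // h; exact: off.
  case: (edge_free_irreducible irrm nem) => [m0|[g mg]]; subst m.
    by case: (no_backtrack irr).
  have gH h : g <> emap G e (~~ b) h.
    by move=> gh; subst g; exact: (no_pinch irr).
  have [K' [ad' ref off]] := dense_edge_subgroup (@resV _) gH adK.
  by exists K'; split=> // h; rewrite /= mulg1; exact: off.
exists K'; split=> // h; rewrite /= eval_cat /= mulg1 stepN mulgA => eh.
apply: (off h); apply: (mulgI (step K' e b)).
by rewrite -step_rel -eh mulgVK.
Qed.

Lemma first_edge_simple_dense u v :
  (forall w t, size t <= size s2 -> irreducible w t w -> has (@is_edge _ _) t ->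
     dense (off_vertex w t)) ->
  irreducible u (s1 ++ Edge e b :: s2) v ->
  dense first_edge_simple.
Proof.
move=> IH irr K adK.
(* There are finitely many crossings in [s2]; they are indexed by position. *)
pose D j K' := forall b' r, drop j s2 = Edge e b' :: r ->
  off_edge e b (recrossing b' (take j s2)) K'.
have perD j : persistent (D j).
  by move=> K1 K2 ref DK b' r dj; exact: off_edge_persistent ref (DK _ _ dj).
have denD j : dense (D j).
  case: (pselect (exists b' r, drop j s2 = Edge e b' :: r)) => [[b' [r dj]]|no];
    last first.
    move=> K1 ad1; exists K1; split=> //; first exact: refines_refl.
    by move=> b' r dj; case: no; exists b', r.
  have ltj : size (take j s2) + 1 <= size s2.
    by rewrite -[X in _ <= size X](cat_take_drop j s2) dj size_cat leq_add2l.
  rewrite -(cat_take_drop j s2) dj in irr.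
  have denj := recrossing_dense (fun w t les => IH w t (leq_trans les ltj)) irr.
  move=> K1 ad1; have [K2 [ad2 ref off]] := denj K1 ad1.
  by exists K2; split=> // b'' r'' ; rewrite dj => -[<- _].
have [K' [ad' ref off]] := dense_forall perD denD (size s2) adK.
exists K'; split=> // m b' r es2.
have := off (size m); rewrite /D es2 size_cat /= drop_size_cat // take_size_cat //.
by apply; rewrite // -addn1 leq_add2l.
Qed.

(** In the fibre coordinate at 1, the twist supported on the coset crossed first
contributes exactly once, whereas vertex group elements have trivial fibre
coordinates. *)
Lemma first_edge_lift u K : admissible K -> ~~ has (@is_edge _ _) s1 ->
  first_edge_simple K ->
  exists K', [/\ admissible K', refines K' K &
                 off_vertex u (s1 ++ Edge e b :: s2) K'].
Proof.
move=> adK ns1 simple.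
have [B [CB [a na]]] := root_nontrivial rC.
have [c cM] := admissible_coordinates adK.
pose rho (v : vertex Gamma) : {multiplicative vgroup G v -> B} := @one_fun _ B.
pose p := eval K s1.
(* Twists are indexed by the [true] end of an edge, where a crossing in the
   direction [false] arrives; [side] moves such a point to the end [b]. *)
pose side k := k * (if b then 1 else step K e true).
pose hit k := exists h, side k = p * vrep K (emap G e b h).
have side_coset k h :
    side (k * vrep K (emap G e true h)) = side k * vrep K (emap G e b h).
  by rewrite /side; case: (b); rewrite ?mulg1 // -!mulgA (step_rel K true).
pose twist (e' : edge Gamma) k := if `[< e' = e /\ hit k >] then a else 1.
have twist_coset e' k h : twist e' (k * vrep K (emap G e' true h)) = twist e' k.
  rewrite /twist; congr (if _ then _ else _).
  apply: asbool_equiv_eq; split=> -[ee]; subst e'; rewrite /hit side_coset => -[h' eh'].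
    by split=> //; exists (h' * h^-1); rewrite !gmulfM !homV mulgA -eh' mulgK.
  by split=> //; exists (h' * h); rewrite eh' !gmulfM mulgA.
pose K' := wreath_lift rho cM twist_coset.
have ref : refines K' K by exact: wreath_lift_refines.
have fibre_step e' b' k : fibre (step K' e' b') k =
    if b' then twist e' k else (twist e' (k * step K e' false))^-1.
  by case: b'; rewrite /= /one_fun invg1 mul1g mulg1.
have away : fibre (eval K' s2) (p * step K e b) = 1.
  apply: fibre_eval => // m e' b' r es2; rewrite fibre_step.
  have nohit (k := p * step K e b * eval K m) :
      ~ (e' = e /\ hit (if b' then k else k * step K e' false)).
    move=> [ee [h hk]]; subst e'; apply: (simple _ _ _ es2 h).
    apply: (mulgI p); rewrite -hk /recrossing /side /k {hk k} /= eval_cat.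
    by case: (b); case: (b') => /=; rewrite ?mulg1 ?mulgVK ?mulgA.
  rewrite /twist; case: (b') nohit => nohit.
    by case: asboolP => // /nohit.
  by case: asboolP => [/nohit|]; rewrite ?invg1.
have hit_p : fibre (step K' e b) p <> 1.
  rewrite fibre_step /twist /hit /side; case: (b).
    by case: asboolP => // -[]; split=> //; exists 1; rewrite !hom1.
  case: asboolP => [_|[]]; first by rewrite -[1]invg1 => /invg_inj.
  by split=> //; exists 1; rewrite !hom1 mulg1 /= mulgVK.
exists K'; split=> //.
  apply: (admissible_refines _ ref adK); apply: wreath_root_class => //.
  by case: (adK).
move=> g /(congr1 (fun x : wreath _ _ => fibre x 1)).
rewrite eval_cat /=.
have before : fibre (eval K' s1) 1 = 1.
  apply: fibre_eval => // s3 e' b' s4 es1.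
  by move: ns1; rewrite es1 has_cat /= orbT.
rewrite before top_eval -/p !mul1g.
rewrite (_ : top (step K' e b) = step K e b); last by case: (b).
by rewrite away mulg1; exact: hit_p.
Qed.

End FirstEdge.

Hypothesis resV : forall v : vertex Gamma, residually C (vgroup G v).

(** Induction on the length opens the shorter closed routes first. *)
Lemma dense_off_vertex u s : irreducible u s u -> has (@is_edge _ _) s ->
  dense (off_vertex u s).
Proof.
elim: {s}(size s) {-2}s u (leqnn (size s)) => [|n IH] s u les irr es.
  by case: s les es irr.
have [s1 [e [b [s2 [sE ns1]]]]] := split_first_edge es.
rewrite sE in irr les *.
have les2 : size s2 <= n.
  by move: les; rewrite size_cat /= addnS ltnS; apply: leq_trans; exact: leq_addl.
move=> K adK.
have [|K1 [ad1 ref1 simple]] := first_edge_simple_dense resV _ irr adK.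
  by move=> w t let2; apply: IH; exact: leq_trans let2 les2.
have [K2 [ad2 ref2 off]] := first_edge_lift u ad1 ns1 simple.
by exists K2; split=> //; exact: refines_trans ref1.
Qed.

Lemma dense_eval_neq1 u s K0 : irreducible u s u -> eval K0 s <> 1 ->
  dense (fun K => eval K s <> 1).
Proof.
move=> irr neq1 K adK; case: (boolP (has (@is_edge _ _) s)) => [es|nes].
  have [K' [ad' ref off]] := dense_off_vertex irr es adK.
  by exists K'; split=> // /= eq1; apply: (off 1); rewrite hom1.
case: (edge_free_irreducible irr nes) => [s0|[g sg]]; subst s => //.
have g1 : g <> 1 by move=> g1; apply: neq1; rewrite /= g1 hom1 mulg1.
have [K' [ad' ref sep]] := dense_vertex (@resV _) g1 adK.
by exists K'; split=> //=; rewrite mulg1.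
Qed.

End Separation.

(** * Walks in a tree *)

(** An innermost repetition: the part of [p] from [e] up to its next occurrence
has no repetition itself. *)
Lemma split_repetition (X : eqType) (p : seq (X * bool)) :
  ~~ uniq [seq x.1 | x <- p] ->
  exists p1 e b p2 b' p3, p = p1 ++ (e, b) :: p2 ++ (e, b') :: p3 /\
    uniq [seq x.1 | x <- (e, b) :: p2].
Proof.
elim: p => [|[e b] p IH] //=; rewrite negb_and negbK orbC.
case: (boolP (uniq [seq x.1 | x <- p])) => [un|/IH] /=; last first.
  move=> [p1 [e1 [b1 [p2 [b' [p3 [-> un]]]]]]] _.
  by exists ((e, b) :: p1), e1, b1, p2, b', p3.
move=> /mapP[[e' b'] /= in_p ee']; subst e'.
case/splitPr: in_p un => p2 p3; rewrite map_cat cat_uniq /= negb_or.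
move=> /and3P[un /andP[notin _] _].
by exists [::], e, b, p2, b', p3; rewrite /= notin.
Qed.

Section TreeWalks.
Variables (Gamma : multigraph) (S : set (edge Gamma)).
Implicit Types (u v w : vertex Gamma) (p q : word (edge Gamma)).

Lemma walk_cat u p q v : walk S u (p ++ q) v <-> exists2 w, walk S u p w & walk S w q v.
Proof.
elim: p u => [|[e b] p IH] u /=; first by split=> [r|[w -> //]]; exists u.
split=> [[Se eu /IH[w r1 r2]]|[w [Se eu r1] r2]]; first by exists w.
by split=> //; apply/IH; exists w.
Qed.

Lemma walk_inv u p v : walk S u p v -> walk S v (word_inv p) u.
Proof.
elim: p u => [|[e b] p IH] u //= [Se eu /IH walk_p].
rewrite /word_inv /= rev_cons -cats1; apply/walk_cat.
by exists (edge_end e (~~ b)) => //=; rewrite negbK.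
Qed.

Variables (G : graph_of_groups Gamma) (K : representation G).

(** At an innermost repetition of an edge, a traversal in the same direction
would close a cycle, and a traversal in the opposite direction encloses a
closed walk without repetition, which is empty; so the two crossings cancel. *)
Lemma closed_walk_eval u p : acyclic S -> walk S u p u -> word_eval (erep K) p = 1.
Proof.
move=> acS; elim: {p}(size p) {-2}p u (leqnn (size p)) => [|n IH] p u lep.
  by case: p lep.
case: (boolP (uniq [seq x.1 | x <- p])) => [un walk_p|].
  by rewrite (acS _ _ walk_p un).
move=> /split_repetition[p1 [e [b [p2 [b' [p3 [pE un]]]]]]].
rewrite pE in lep *; move=> /walk_cat[w walk1 [Se ew /walk_cat[w' walk2 [_ ew' walk3]]]].
subst w w'; have [b'b|nb'] := eqVneq b' b.
  by subst b'; have := acS (edge_end e b) ((e, b) :: p2) (And3 Se erefl walk2) un.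
have {nb'}b'E : b' = ~~ b by case: (b) (b') nb' => [] [].
subst b'; have {walk2}p20 : p2 = [::].
  by apply: acS walk2 _; case/andP: un.
subst p2; rewrite negbK in walk3.
have := IH (p1 ++ p3) u; rewrite !word_eval_cat /= => IHp.
rewrite (_ : _ * (_ * word_eval _ p3) = word_eval (erep K) p3); last first.
  by case: (b) => /=; rewrite ?mulVKg ?mulKg.
apply: IHp; last by apply/walk_cat; exists (edge_end e b).
move: lep; rewrite !size_cat /= !addnS ltnS; apply: leq_trans; exact: leqnSn.
Qed.

Lemma walk_eval_unique u v p q : acyclic S -> walk S u p v -> walk S u q v ->
  word_eval (erep K) p = word_eval (erep K) q.
Proof.
move=> acS walk_p walk_q; apply: divg1_eq; rewrite -word_eval_inv -word_eval_cat.
apply: (closed_walk_eval (u := u)) => //.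
by apply/walk_cat; exists v => //; exact: walk_inv.
Qed.

Definition walk_letters p : seq (letter G) := [seq Edge x.1 x.2 | x <- p].

Lemma route_walk u p v : walk S u p v -> route u (walk_letters p) v.
Proof. by elim: p u => [|[e b] p IH] u //= [_ -> /IH]. Qed.

Lemma eval_walk p : eval K (walk_letters p) = word_eval (erep K) p.
Proof. by elim: p => [|[e b] p IH] //=; rewrite IH. Qed.

End TreeWalks.

(** * Representations and the fundamental group *)

Section FundamentalGroup.
Variables (Gamma : multigraph) (G : graph_of_groups Gamma) (T : set (edge Gamma)).
Variables (v0 : vertex Gamma) (path_to : vertex Gamma -> word (edge Gamma)).
Hypothesis path_toP : forall v, walk T v0 (path_to v) v.
Hypothesis acT : acyclic T.

Implicit Types K : representation G.

Definition transport K v : target K := word_eval (erep K) (path_to v).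

(** Each generator becomes a loop at [v0] through the tree, so that the loops of
tree edges are trivial as the presentation demands ([transport_edge]). *)
Definition gen_value K (x : pi1_gen G T) : target K :=
  match x with
  | VGen v g => transport K v * vrep K g * (transport K v)^-1
  | TGen e _ => transport K (edge_end e true) * erep K e *
                (transport K (edge_end e false))^-1
  end.

Lemma transport_edge K e : T e ->
  transport K (edge_end e false) = transport K (edge_end e true) * erep K e.
Proof.
move=> Te; rewrite (_ : erep K e = word_eval (erep K) [:: (e, true)]); last first.
  by rewrite /= mulg1.
rewrite /transport -word_eval_cat; apply: walk_eval_unique (path_toP _) _ => //.
by apply/walk_cat; exists (edge_end e true).
Qed.

Lemma pi1_hom K : exists s : {multiplicative pi1 G T -> target K},
  forall u, s (pres_class (@pi1_rel _ G T) u) = word_eval (gen_value K) u.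
Proof.
apply: presented_hom => _ _ [v g h|e h Te|e nTe h] /=; rewrite !mulg1.
- by rewrite gmulfM !mulgA mulgVK.
- by rewrite transport_edge // invgM !mulgA -(mulgA _ (erep K e)) -erep_rel !mulgA mulgK.
- by rewrite !invgM invgK !mulgA !mulgVK -[_ * erep K e]mulgA erep_rel !mulgA mulgVK.
Qed.

Lemma word_route (u : word (pi1_gen G T)) :
  exists2 s, route v0 s v0 & forall K, eval K s = word_eval (gen_value K) u.
Proof.
elim: u => [|[x b] u [s rs es]]; first by exists [::].
suff [t rt et] : exists2 t, route v0 t v0 &
    forall K, eval K t = if b then gen_value K x else (gen_value K x)^-1.
  by exists (t ++ s) => [|K]; [apply/route_cat; exists v0|rewrite eval_cat et es].
have there v := route_walk G (path_toP v).
have back v := route_walk G (walk_inv (path_toP v)).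
case: x => [v g|e nTe] /=.
  exists (walk_letters G (path_to v) ++ Vert (if b then g else g^-1) ::
          walk_letters G (word_inv (path_to v))) => [|K].
    by apply/route_cat; exists v => //=.
  rewrite eval_cat /= !eval_walk word_eval_inv mulgA -/(transport K v).
  by case: (b); rewrite // !invgM invgK homV mulgA.
exists (walk_letters G (path_to (edge_end e b)) ++ Edge e b ::
        walk_letters G (word_inv (path_to (edge_end e (~~ b))))) => [|K].
  by apply/route_cat; exists (edge_end e b) => //=.
rewrite eval_cat /= !eval_walk word_eval_inv mulgA -!/(transport K _).
by case: (b); rewrite // !invgM invgK mulgA.
Qed.

Definition stable_letter (e : edge Gamma) : pi1 G T :=
  if pselect (T e) is right nTe then pres_class _ [:: (TGen G nTe, true)] else 1.

Fact stable_letter_rel e h :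
  vertex_incl G T _ (emap G e true h) * stable_letter e =
  stable_letter e * vertex_incl G T _ (emap G e false h).
Proof.
rewrite /stable_letter; case: pselect => [Te|nTe].
  rewrite mulg1 mul1g; apply/pres_classP/PresRel; exact: TreeRel.
rewrite [LHS]pres_mulE [RHS]pres_mulE; apply/pres_classP.
set t := (TGen G nTe, true); set t' := (TGen G nTe, false).
set h1 := (VGen T (emap G e true h), true); set h2 := (VGen T (emap G e false h), true).
apply: (@PresTrans _ _ _ ([:: t] ++ [:: t'; h1; t])).
  apply: (PresCat (u := [::]) (u' := [:: t; t'])); last exact: PresRefl.
  apply: PresSym; exact: (PresCancel _ _ true).
by apply: PresCat; [exact: PresRefl|exact/PresRel/StableRel].
Qed.

(** The representation in the fundamental group itself: a route of [x] takes the
value [x] there, so it cannot be shortened to a trivial one when [x <> 1]. *)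
Definition universal_rep : representation G :=
  @Representation Gamma G (pi1 G T)
    (fun v => vertex_incl G T v) stable_letter stable_letter_rel.

Lemma tree_walk_universal u p v : walk T u p v -> word_eval (erep universal_rep) p = 1.
Proof.
elim: p u => [|[e b] p IH] u //= [Te _ /IH->].
by rewrite /stable_letter; case: pselect => // _; case: (b); rewrite ?invg1 mulg1.
Qed.

Lemma universal_rep_value u :
  word_eval (gen_value universal_rep) u = pres_class (@pi1_rel _ G T) u.
Proof.
rewrite -word_eval_class; apply: eq_word_eval => -[v g|e nTe] /=.
  by rewrite /transport !(tree_walk_universal (path_toP _)) invg1 mulg1 mul1g.
rewrite /transport !(tree_walk_universal (path_toP _)) invg1 mulg1 mul1g.
rewrite /stable_letter; case: pselect => // nTe'.
by rewrite (Prop_irrelevance nTe' nTe).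
Qed.

End FundamentalGroup.

Theorem theorem1 (C : groupType -> Prop) (Gamma : multigraph)
    (G : graph_of_groups Gamma) (T : set (edge Gamma)) :
  inhabited (vertex Gamma) ->
  connected (@setT (edge Gamma)) ->
  maximal_tree T ->
  root_class C ->
  (forall v : vertex Gamma, residually C (vgroup G v)) ->
  (exists (Q : groupType) (sigma : {multiplicative pi1 G T -> Q}),
    [/\ C Q, surjective sigma &
        forall (e : edge Gamma) (b : bool),
          {in edge_subgroup G e b &,
             injective (fun g => sigma (vertex_incl G T (edge_end e b) g))}]) ->
  residually C (pi1 G T).
Proof.
move=> [v0] _ [conT acT] rC resV [Q [sigma [CQ _ inj]]] x x1.
pose path_to v := sval (cid (conT v0 v)).
have path_toP v : walk T v0 (path_to v) v by exact: svalP (cid (conT v0 v)).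
pose U := universal_rep G T.
have K0_rel e h : (sigma \o vrep U) (emap G e true h) * sigma (erep U e) =
    sigma (erep U e) * (sigma \o vrep U) (emap G e false h).
  by rewrite /= -!gmulfM; exact: (congr1 sigma (@erep_rel _ _ U e h)).
pose K0 := @Representation Gamma G Q (fun v => sigma \o vrep U) (sigma \o erep U) K0_rel.
have ad0 : admissible C K0.
  split=> // e b h h' eh; apply: (@emap_inj _ G e b); apply: (inj e b) => //.
    by apply: mem_set; exists h.
  by apply: mem_set; exists h'.
have [s rs es] := word_route path_toP (pres_repr x).
have [s' irr es'] := exists_irreducible rs.
have neq1 : eval U s' <> 1.
  by rewrite es' es (universal_rep_value path_toP) pres_reprK.
have [K [[CK _] _ sep]] := dense_eval_neq1 rC resV irr neq1 ad0.
have [f fE] := pi1_hom path_toP acT K.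
exists (image_group f), (to_image f); split.
- apply: (root_subgroup rC (i := val : {multiplicative image_group f -> _})) CK.
  exact: val_inj.
- exact: to_image_surjective.
- move=> /(congr1 val) /= fx; apply: sep.
  by rewrite es' es -fE pres_reprK fx.
Qed.
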